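(* Let $0 \le \Delta < 1$ and $a > 0$, and let $\eta_t=\{l_t,r_t\}$ be the two-point linear edge-reinforced process on $\mathbb{Z}$ with drift $\Delta$ and initial edge weight $a$, started from $l_0 < r_0$. Let $\tau_1 = \inf\{t \ge 0 : l_t = r_t\}$ be the first meeting time of the two particles. Then $\tau_1 < \infty$ almost surely.
   Context: The two-point linear edge-reinforced process on $\mathbb{Z}$ with drift $\Delta \ge 0$ and initial weight $a>0$ is defined as follows. Every edge $[v,v+1]$, $v\in\mathbb{Z}$, carries a weight $W_t(v,v+1)$, with $W_0(v,v+1)=a$ for all $v$. Two particles move on $\mathbb{Z}$; each carries an independent rate-one exponential clock (independent exponential waiting times with rate one between its jumps). When the clock of a particle located at site $v$ rings at time $t$, the particle jumps to $v+1$ with probability $$\frac{W_{t-}(v,v+1)+\Delta}{W_{t-}(v-1,v)+W_{t-}(v,v+1)+\Delta}$$ and to $v-1$ with probability $$\frac{W_{t-}(v-1,v)}{W_{t-}(v-1,v)+W_{t-}(v,v+1)+\Delta},$$ and the weight of the traversed edge is increased by $1$ (all other weights unchanged). The weights are shared by both particles. Denote by $l_t$ the position of the left particle and by $r_t$ that of the right particle at time $t$ (so $l_t \le r_t$; when $l_t=r_t$ the labels are immaterial). *)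

(* Defs.v *)
From HB Require Import structures.
From mathcomp Require Import all_boot all_order all_algebra.
From mathcomp Require Import all_classical all_reals all_analysis.
Set Implicit Arguments. Unset Strict Implicit. Unset Printing Implicit Defensive.
Import Order.TTheory GRing.Theory Num.Theory.
Local Open Scope classical_set_scope.
Local Open Scope ring_scope.

Definition mutually_independent (d : measure_display) (T : measurableType d)
  (R : realType) (P : probability T R) (I : eqType) (X : I -> T -> R) : Prop :=
  forall (F : seq I), uniq F ->
  forall B : I -> set R, (forall i, measurable (B i)) ->
  P (\bigcap_(i in [set` F]) (X i @^-1` B i)) =
  (\prod_(i <- F) P (X i @^-1` B i))%E.

Definition is_exp1 (d : measure_display) (T : measurableType d)
  (R : realType) (P : probability T R) (X : T -> R) : Prop :=
  forall t : R, 0 <= t -> P [set w | t < X w] = (expR (- t))%:E.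

Definition is_unif01 (d : measure_display) (T : measurableType d)
  (R : realType) (P : probability T R) (U : T -> R) : Prop :=
  forall x : R, 0 <= x <= 1 -> P [set w | U w <= x] = x%:E.

(* Deterministic construction of the two-point linear edge-reinforced     *)
(* process from its randomness:                                            *)
(*  e1 m, e2 m : the m-th waiting time of the clock of particle A, B;     *)
(*  u n       : the uniform variable used for the direction at the n-th   *)
(*              jump of the whole system.                                 *)
(* Edge [v, v+1] is indexed by v.                                          *)

Record lerp_state (R : realType) := LState {
  posA : int;
  posB : int;
  wts  : int -> R;       (* wts v = weight of edge [v, v+1] *)
  cnt1 : nat;            (* number of rings of A's clock so far *)
  cnt2 : nat;            (* number of rings of B's clock so far *)
  time : R               (* time of the last jump (0 initially) *)
}.

Definition upd (R : realType) (w : int -> R) (v : int) (c : R) : int -> R :=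
  fun x => if x == v then c else w x.

Definition lerp_jump (R : realType) (D : R) (w : int -> R) (v : int) (x : R)
  : int * (int -> R) :=
  let pr := (w v + D) / (w (v - 1) + w v + D) in
  if x < pr then (v + 1, upd w v (w v + 1))
  else (v - 1, upd w (v - 1) (w (v - 1) + 1)).

(* ring time (k+1-th ring, k counted from 0) of a clock with waiting times e *)
Definition ring_time (R : realType) (e : nat -> R) (k : nat) : R :=
  \sum_(m < k.+1) e m.

Definition lerp_step (R : realType) (D : R) (e1 e2 : nat -> R) (x : R)
  (s : lerp_state R) : lerp_state R :=
  let t1 := ring_time e1 (cnt1 s) in
  let t2 := ring_time e2 (cnt2 s) in
  if t1 <= t2 then
    let j := lerp_jump D (wts s) (posA s) x in
    LState j.1 (posB s) j.2 (cnt1 s).+1 (cnt2 s) t1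
  else
    let j := lerp_jump D (wts s) (posB s) x in
    LState (posA s) j.1 j.2 (cnt1 s) (cnt2 s).+1 t2.

Fixpoint lerp_traj (R : realType) (D a : R) (x0 y0 : int)
  (e1 e2 u : nat -> R) (n : nat) : lerp_state R :=
  match n with
  | 0 => LState x0 y0 (fun _ => a) 0 0 0
  | n'.+1 => lerp_step D e1 e2 (u n') (lerp_traj D a x0 y0 e1 e2 u n')
  end.

(* first meeting time tau_1 = inf {t >= 0 : l_t = r_t}; since the process
   is piecewise constant, right-continuous, with jumps at the times
   [time (lerp_traj .. n)], this is the infimum of the jump times after
   which both particles sit on the same site (+oo if they never meet). *)
Definition meeting_time (R : realType) (D a : R) (x0 y0 : int)
  (e1 e2 u : nat -> R) : \bar R :=
  ereal_inf [set (time (lerp_traj D a x0 y0 e1 e2 u n))%:E | n in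
             [set n | posA (lerp_traj D a x0 y0 e1 e2 u n) =
                      posB (lerp_traj D a x0 y0 e1 e2 u n)]].

Definition lerp_family (d : measure_display) (T : measurableType d)
  (R : realType) (E1 E2 U : nat -> T -> R) : nat + nat + nat -> T -> R :=
  fun i => match i with
           | inl (inl n) => E1 n
           | inl (inr n) => E2 n
           | inr n => U n
           end.

(* Main.v *)
(* Until they meet, let X be the sum of 1/w over the edges w between the two
   particles. A jump removes 1/w when it shortens the gap and adds 1/(w + 1) when
   it widens it, so for D <= 1 the process X is a nonnegative supermartingale: a
   jump from v lowers X on average by at least
     c = (1 - D) / ((w(v-1) + w(v) + D) (w_out + 1)),
   w_out being the edge at v that leads away from the other particle. Hence the
   sum of these costs c is almost surely finite. Without a meeting this is
   impossible. The first jump from a site newly reached in the outward direction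
   has a cost that depends only on a and D, so both particles stay in a bounded
   interval; if, say, the left one jumps infinitely often, then at the site
   v = liminf l_n the weight w(v-1) is eventually constant while w(v) grows by 2
   from one visit to the next, and the costs add up like a harmonic series.
   The order in which the clocks ring only has to be independent of the uniform
   variables. *)
Require Import Defs.
From HB Require Import structures.
From mathcomp Require Import all_boot all_order all_algebra.
From mathcomp Require Import all_classical all_reals all_analysis.
From mathcomp Require Import measurable_realfun ring lra zify.
Set Implicit Arguments.
Unset Strict Implicit.
Import Order.TTheory GRing.Theory Num.Theory.
Import numFieldNormedType.Exports.
Local Open Scope classical_set_scope.
Local Open Scope ring_scope.

(** * Walkers with summable costs *)

Lemma bounded_sum_small (R : realType) (g : nat -> R) (C eps : R) :
  (forall k, 0 <= g k) -> (forall N, \sum_(k < N) g k <= C) -> 0 < eps ->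
  exists N, forall k, (N <= k)%N -> g k < eps.
Proof.
move=> g0 gC e0.
have cg : cvgn (series g).
  apply: nondecreasing_is_cvgn.
    apply/nondecreasing_seqP => n.
    by rewrite /series /= big_nat_recr //= lerDl.
  by exists C => _ [n _ <-]; rewrite /series /= big_mkord.
have /cvgr0Pnorm_lt /(_ eps e0) [N _ H] := cvg_series_cvg_0 cg.
exists N => k Nk; have := H k Nk; by rewrite ger0_norm.
Qed.

(** Take [u] to be the least eventual upper bound; if it were attained only finitely often, [u - 1]
    would be an eventual upper bound as well. *)
Lemma int_limsup (z : nat -> int) (L M : int) :
  (forall n, L <= z n) -> (forall n, z n <= M) ->
  exists u N1, (forall n, (N1 <= n)%N -> z n <= u) /\
    forall N, exists2 n, (N <= n)%N & z n = u.
Proof.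
move=> zL zM.
pose P (i : nat) := `[< exists N, forall n, (N <= n)%N -> z n <= L + i%:Z >].
have exP : exists i, P i.
  exists `|M - L|%N; apply/asboolP; exists 0%N => n _.
  by have := zM n; have := zL n; lia.
case: (ex_minnP exP) => i /asboolP [N1 HN1] imin.
exists (L + i%:Z), N1; split => // N; apply: contrapT => H.
have {}H n : (N <= n)%N -> z n <> L + i%:Z by move=> Nn E; apply: H; exists n.
case: i HN1 imin H => [|i] HN1 imin H.
  have := H (maxn N N1) (leq_maxl _ _); have := HN1 _ (leq_maxr N N1).
  by have := zL (maxn N N1); lia.
have /imin : P i; last by lia.
apply/asboolP; exists (maxn N N1) => n; rewrite geq_max => /andP[n1 n2].
by have := H n n1; have := HN1 n n2; lia.
Qed.

(** One particle seen alone, oriented so that the other one is below it. [b n] says that it moves at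
    time [n]; otherwise the other particle moves and, as they do not meet, leaves the edges from
    [z n - 1] upwards unchanged. *)
Section OuterWalker.
Context (R : realType).
Variables (K D : R) (z : nat -> int) (W : nat -> int -> R) (b : nat -> bool).
Hypotheses (K0 : 0 < K) (D0 : 0 <= D).
Hypothesis moveP : forall n, b n ->
  (z n.+1 = z n + 1 /\
     forall x, W n.+1 x = if x == z n then W n x + 1 else W n x) \/
  (z n.+1 = z n - 1 /\
     forall x, W n.+1 x = if x == z n - 1 then W n x + 1 else W n x).
Hypothesis stayP : forall n, ~~ b n ->
  z n.+1 = z n /\ forall x : int, z n - 1 <= x -> W n.+1 x = W n x.
Hypothesis W0 : forall n x, 0 < W n x.

Let g k := if b k then
  K / ((W k (z k - 1) + W k (z k) + D) * (W k (z k) + 1)) else 0.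

Lemma walker_g_ge0 k : 0 <= g k.
Proof.
rewrite /g; case: ifP => // _; have := W0 k (z k); have := W0 k (z k - 1).
by move: K0 D0 => ? ? ? ?; rewrite divr_ge0 ?mulr_ge0 //; lra.
Qed.

(* Between two consecutive moves from [u := limsup z] only the edge below [u]
   gains weight, and exactly 2, so the costs of these moves dominate a harmonic
   series. *)
Lemma walker_not_oscillating (C : R) (l m : int) :
  (forall N, \sum_(k < N) g k <= C) ->
  (forall n, l <= z n) -> (forall n, z n <= m) ->
  ~ (forall N, exists2 n, (N <= n)%N & b n).
Proof.
move=> gC zl zm bio; move: (K0) (D0) => Kp Dp.
have [u [N1 [uN1 uio]]] := int_limsup zl zm.
(* A walker at [u] stays there until its next move, which is then a move from [u]; the induction is
   on the time left until some later move [k]. *)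
have visit N : exists n, [/\ (N <= n)%N, z n = u & b n].
  have [n Nn zn] := uio N; have [k nk bk] := bio n.
  have {nk} : (k - n + n)%N = k by rewrite subnK.
  move: (k - n)%N => j; elim: j n Nn zn => [|j IH] n Nn zn E.
    by exists n; split => //; rewrite add0n in E; rewrite E.
  have [bn|bn] := boolP (b n); first by exists n.
  have [zs _] := stayP bn.
  by apply: (IH n.+1); [lia | rewrite zs | rewrite -E; lia].
pose c := W N1 u.
(* After [N1] the walker stays at or below [u], so it never crosses the edge above [u]. *)
have Wc n : (N1 <= n)%N -> W n u = c.
  elim: n => [|n IH] Nn; first by move: Nn; rewrite leqn0 /c => /eqP ->.
  move: Nn; rewrite leq_eqVlt => /orP[/eqP <- //|]; rewrite ltnS => Nn.
  rewrite -IH //; have zn := uN1 n Nn; have zn1 := uN1 n.+1 (leqW Nn).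
  have [bn|bn] := boolP (b n); last by have [_ ->] := @stayP n bn => //; lia.
  by have [[zs ->]|[zs ->]] := @moveP n bn; rewrite ifF //; lia.
have c0 : 0 < c by exact: W0.
pose y n := W n (u - 1) + c + D.
have y0 n : 0 < y n by rewrite /y; have := W0 n (u - 1); lra.
(* The cases: a departure from [u], a return from [u - 1], and anything else, which does not cross
   the edge below [u]. *)
have step n : (N1 <= n)%N ->
  [\/ [/\ z n = u, b n, z n.+1 <> u & y n.+1 = y n + 1],
      [/\ z n <> u, z n.+1 = u & y n.+1 = y n + 1] |
      (z n = u <-> z n.+1 = u) /\ y n.+1 = y n].
  move=> Nn; have zn := uN1 n Nn; have zn1 := uN1 n.+1 (leqW Nn).
  rewrite /y; have [bn|bn] := boolP (b n); last first.
    by apply: Or33; have [-> ->] := @stayP n bn => //; lia.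
  have [[zs ->]|[zs ->]] := @moveP n bn; last first.
    have [zu|zu] := eqVneq (z n) u.
      apply: Or31; split => //; first lia.
      by rewrite zu eqxx; lra.
    apply: Or33; split; first by lia.
    by rewrite ifF //; lia.
  have [zu|zu] := eqVneq (z n) (u - 1).
    apply: Or32; split; [lia|lia|].
    by lra.
  by apply: Or33; split => //; lia.
(* Chosen so that a move from [u] costs exactly [K' * (2 / y n)]. *)
pose K' := K / (c + 1) / 2.
have K'0 : 0 < K' by rewrite !divr_gt0 //; lra.
(* The extra 1 away from [u] books the next return in advance. So [Phi] changes only at departures,
   by ln (1 + 2 / y n) <= 2 / y n, which the cost covers. *)
pose Phi n := ln (y n + (if z n == u then 0 else 1)).
have PhiP n : (N1 <= n)%N ->
    K' * (Phi n - Phi N1) <= \sum_(k < n) g k.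
  elim: n => [|n IH] Nn.
    by move: Nn; rewrite leqn0 => /eqP ->; rewrite subrr mulr0 big_ord0.
  move: Nn; rewrite leq_eqVlt => /orP[/eqP <- |].
    by rewrite subrr mulr0 sumr_ge0 // => k _; exact: walker_g_ge0.
  rewrite ltnS => Nn; rewrite big_ord_recr /=.
  have {}IH := IH Nn; have g0 := walker_g_ge0 n.
  have [[zu bn zs ys]|[zu zs ys]|[zs ys]] := step n Nn.
  - suff : K' * (Phi n.+1 - Phi n) <= g n.
      by rewrite !mulrBr in IH *; lra.
    rewrite /Phi zu eqxx (negbTE (introN eqP zs)) addr0 ys.
    have -> : g n = K' * (2 / y n).
      rewrite /g bn zu (Wc n Nn) -/(y n) /K'.
      by have := y0 n; move=> ?; field; lra.
    rewrite ler_pM2l // -ln_div ?posrE; [|have := y0 n; lra|exact: y0].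
    have -> : (y n + 1 + 1) / y n = 1 + 2 / y n.
      by have := y0 n; move=> ?; field; lra.
    apply: le_ln1Dx; apply: (@lt_le_trans _ _ 0); first by lra.
    by rewrite divr_ge0 // ltW.
  - rewrite /Phi zs eqxx (negbTE (introN eqP zu)) ys in IH *.
    by rewrite addr0; lra.
  - have -> : Phi n.+1 = Phi n; last by lra.
    rewrite /Phi ys; do 2 case: eqP => //; tauto.
have ygrow j : exists2 n, (N1 <= n)%N & j%:R <= y n.
  elim: j => [|j [n Nn IH]]; first by exists N1 => //; exact/ltW/y0.
  have ymono k : y n <= y (n + k)%N.
    elim: k => [|k IHk]; first by rewrite addn0.
    have Nnk : (N1 <= n + k)%N by rewrite (leq_trans Nn) // leq_addr.
    by rewrite addnS; have [[_ _ _ ->]|[_ _ ->]|[_ ->]] := step _ Nnk; lra.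
  have [n' [nn' zu bn]] := visit n; have Nn' := leq_trans Nn nn'.
  exists n'.+1; first exact: leqW.
  have := ymono (n' - n)%N; rewrite subnKC // => ynn'.
  have [[_ _ _ ->]|[//]|[h _]] := step n' Nn'; first by rewrite -natr1; lra.
  have zs := h.1 zu; have := @moveP n' bn; rewrite zs zu.
  by case=> -[]; lia.
(* Once [Phi n] exceeds [B], the lower bound in [PhiP] exceeds [C]. *)
pose B := C / K' + Phi N1 + 1.
have [n Nn yn] := ygrow (Num.Def.truncn (expR B)).+1.
have := PhiP n Nn; have := gC n.
have : B < Phi n.
  rewrite -(@expRK _ B) /Phi ltr_ln ?posrE ?expR_gt0 //.
    apply: (lt_le_trans (truncnS_gt _)); apply: (le_trans yn).
    by rewrite lerDl; case: ifP.
  by rewrite ltr_pwDl //; case: ifP.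
rewrite /B => h1 h2 h3.
have : C < K' * (Phi n - Phi N1).
  by rewrite mulrC -ltr_pdivrMr //; lra.
by lra.
Qed.

Variable a : R.
Hypothesis a0 : 0 < a.
Hypothesis Wa : forall x : int, z 0 <= x -> W 0 x = a.

Lemma walker_outside n :
  z n <= z 0 + n%:Z /\ forall x, z 0 + n%:Z <= x -> W n x = a.
Proof.
elim: n => [|n [IH1 IH2]]; first by rewrite addr0; split.
have [bn|bn] := boolP (b n).
- have [[-> H]|[-> H]] := @moveP n bn.
  + split; first lia.
    by move=> x xn; rewrite H ifF ?IH2 //; lia.
  + split; first lia.
    by move=> x xn; rewrite H ifF ?IH2 //; lia.
- have [-> H] := @stayP n bn; split; first lia.
  by move=> x xn; rewrite H ?IH2 //; lia.
Qed.

(* At a site reached for the first time the cost [g] of the next move is a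
   fixed constant, so summability of [g] leaves finitely many new sites. *)
Lemma walker_bounded C : (forall N, \sum_(k < N) g k <= C) ->
  exists M, forall n, z n <= M.
Proof.
move=> gC; move: (K0) (D0) (a0) => Kp Dp ap.
(* The cost of leaving a new site: the edge below it was crossed once, the edge above it never. *)
pose eps := K / ((a + 1 + a + D) * (a + 1)).
have e0 : 0 < eps by rewrite divr_gt0 // mulr_gt0; lra.
have [N HN] := bounded_sum_small walker_g_ge0 gC e0.
pose m := z 0 + N%:Z.
(* At time [N] no edge from [m] upwards has been used, and from then on every cost is below [eps].
   Once the walker stands on [m + 1] it is stuck there, because leaving would cost exactly [eps]. *)
have Hm k : (z (N + k)%N <= m /\ forall x, m <= x -> W (N + k)%N x = a) \/
    [/\ z (N + k)%N = m + 1, W (N + k)%N m = a + 1 &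
        forall x, m + 1 <= x -> W (N + k)%N x = a].
  elim: k => [|k IH]; first by left; rewrite addn0; exact: walker_outside.
  rewrite addnS; set n := (N + k)%N in IH *.
  have [bn|bn] := boolP (b n).
    case: IH => [[IH1 IH2]|[IH1 IH2 IH3]].
      have [[-> H]|[-> H]] := @moveP n bn.
        have [zm|zm] := eqVneq (z n) m.
          right; split; first lia.
            by rewrite H zm eqxx IH2.
          by move=> x xm; rewrite H ifF ?IH2 //; lia.
        left; split; first lia.
        by move=> x xm; rewrite H ifF ?IH2 //; lia.
      left; split; first lia.
      by move=> x xm; rewrite H ifF ?IH2 //; lia.
    have := HN n (leq_addr _ _); rewrite /g bn IH1.
    have -> : m + 1 - 1 = m by lia.
    by rewrite IH2 IH3 // ltxx.
  have [-> H] := @stayP n bn; case: IH => [[IH1 IH2]|[IH1 IH2 IH3]].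
    by left; split => // x xm; rewrite H ?IH2 //; lia.
  right; split => //; first by rewrite H //; lia.
  by move=> x xm; rewrite H ?IH3 //; lia.
exists (z 0 + N%:Z + 1) => n.
have [nN|Nn] := leqP n N.
  by have [+ _] := walker_outside n; lia.
by have := Hm (n - N)%N; rewrite subnKC ?(ltnW Nn) //; rewrite -/m; move=> [[]|[]]; lia.
Qed.
End OuterWalker.

(** * Energy of a configuration *)

Record config (R : realType) := Config {
  lpos : int;
  rpos : int;
  weight : int -> R
}.

Definition mover_site (R : realType) (b : bool) (s : config R) : int :=
  if b then lpos s else rpos s.

Definition right_prob (R : realType) (D : R) (w : int -> R) (v : int) : R :=
  (w v + D) / (w (v - 1) + w v + D).

Definition jump (R : realType) (w : int -> R) (v : int) (right : bool)
    : int * (int -> R) :=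
  if right then (v + 1, upd w v (w v + 1))
  else (v - 1, upd w (v - 1) (w (v - 1) + 1)).

(* The process is frozen at the first meeting; [b] selects the left particle. *)
Definition move (R : realType) (s : config R) (b right : bool) : config R :=
  if lpos s == rpos s then s
  else let j := jump (weight s) (mover_site b s) right in
    if b then Config j.1 (rpos s) j.2 else Config (lpos s) j.1 j.2.

(* Effective resistance between the two particles. *)
Definition energy (R : realType) (s : config R) : R :=
  \sum_(i < `|rpos s - lpos s|%N) (weight s (lpos s + i%:Z))^-1.

Definition cost (R : realType) (D : R) (s : config R) (b : bool) : R :=
  if lpos s == rpos s then 0 else
  let v := mover_site b s in
  (1 - D) / ((weight s (v - 1) + weight s v + D) *
             (weight s (if b then v - 1 else v) + 1)).

Definition admissible (R : realType) (s : config R) : Prop :=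
  lpos s <= rpos s /\ forall x, 0 < weight s x.

Lemma upd_gt0 (R : realType) (w : int -> R) v c :
  (forall x, 0 < w x) -> 0 < c -> forall x, 0 < upd w v c x.
Proof. by move=> w0 c0 x; rewrite /upd; case: ifP. Qed.

Lemma admissible_move (R : realType) (s : config R) b right :
  admissible s -> admissible (move s b right).
Proof.
case: s => A B w [/= AB w0]; rewrite /move /=; have [//|nAB] := eqVneq A B.
rewrite /jump /mover_site; case: b; case: right; split => /=; try lia;
  apply: upd_gt0 => //; by rewrite addr_gt0.
Qed.

Lemma right_prob_01 (R : realType) (D : R) (w : int -> R) v :
  0 <= D -> (forall x, 0 < w x) -> 0 <= right_prob D w v <= 1.
Proof.
move=> D0 w0; rewrite /right_prob; have := w0 v; have := w0 (v - 1) => h1 h2.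
by rewrite divr_ge0 ?ler_pdivrMr; lra.
Qed.

Lemma energy_ge0 (R : realType) (s : config R) : admissible s -> 0 <= energy s.
Proof. by move=> [_ w0]; apply: sumr_ge0 => i _; rewrite invr_ge0 ltW. Qed.

Lemma cost_ge0 (R : realType) (D : R) (s : config R) b :
  0 <= D -> D < 1 -> admissible s -> 0 <= cost D s b.
Proof.
move=> D0 D1 [_ w0]; rewrite /cost; case: ifP => // _.
set v := mover_site _ _; set u := if b then _ else _.
have := w0 v; have := w0 (v - 1); have := w0 u => h1 h2 h3.
by rewrite divr_ge0 ?mulr_ge0 //; lra.
Qed.

Lemma energyE (R : realType) (A : int) n (w : int -> R) :
  energy (Config A (A + n%:Z) w) = \sum_(i < n) (w (A + i%:Z))^-1.
Proof. by rewrite /energy /= addrAC subrr add0r. Qed.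

Lemma energy_move_ll (R : realType) (A B : int) (w : int -> R) : A < B ->
  energy (move (Config A B w) true false) =
  energy (Config A B w) + (w (A - 1) + 1)^-1.
Proof.
move=> AB; rewrite /move /= lt_eqF //= /jump /mover_site /=.
have -> : B = A + `|B - A|%N%:Z by lia.
set n := `|B - A|%N; rewrite energyE.
have -> : A + n%:Z = A - 1 + n.+1%:Z by lia.
rewrite energyE big_ord_recl addr0 /upd eqxx addrC; congr (_ + _).
apply: eq_bigr => i _; rewrite lift0.
have -> : A - 1 + i.+1%:Z = A + i%:Z by lia.
by rewrite ifF //; lia.
Qed.

Lemma energy_move_lr (R : realType) (A B : int) (w : int -> R) : A < B ->
  energy (move (Config A B w) true true) =
  energy (Config A B w) - (w A)^-1.
Proof.
move=> AB; rewrite /move /= lt_eqF //= /jump /mover_site /=.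
have -> : B = A + `|B - A|.-1%N.+1%:Z by lia.
set n := _.-1; rewrite energyE.
have -> : A + n.+1%:Z = A + 1 + n%:Z by lia.
rewrite energyE big_ord_recl addr0 addrAC subrr add0r.
apply: eq_bigr => i _; rewrite lift0 /upd.
have -> : A + 1 + i%:Z = A + i.+1%:Z by lia.
by rewrite ifF //; lia.
Qed.

Lemma energy_move_rr (R : realType) (A B : int) (w : int -> R) : A < B ->
  energy (move (Config A B w) false true) =
  energy (Config A B w) + (w B + 1)^-1.
Proof.
move=> AB; rewrite /move /= lt_eqF //= /jump /mover_site /=.
have -> : B = A + `|B - A|%N%:Z by lia.
set n := `|B - A|%N; rewrite energyE.
have -> : A + n%:Z + 1 = A + n.+1%:Z by lia.
rewrite energyE big_ord_recr /= /upd eqxx; congr (_ + _).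
by apply: eq_bigr => i _; rewrite ifF //; have := ltn_ord i; lia.
Qed.

Lemma energy_move_rl (R : realType) (A B : int) (w : int -> R) : A < B ->
  energy (move (Config A B w) false false) =
  energy (Config A B w) - (w (B - 1))^-1.
Proof.
move=> AB; rewrite /move /= lt_eqF //= /jump /mover_site /=.
have -> : B = A + `|B - A|.-1%N.+1%:Z by lia.
set n := _.-1; rewrite energyE.
have -> : A + n.+1%:Z - 1 = A + n%:Z by lia.
rewrite energyE big_ord_recr /= addrK.
by apply: eq_bigr => i _; rewrite /upd ifF //; have := ltn_ord i; lia.
Qed.

(* The hypothesis [D <= 1] is what makes the move of the right particle, which
   is pushed away from the left one, decrease the energy on average. *)
Lemma energy_drift (R : realType) (D : R) (s : config R) b :
  0 <= D -> D <= 1 -> admissible s ->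
  let p := right_prob D (weight s) (mover_site b s) in
  p * energy (move s b true) + (1 - p) * energy (move s b false)
    <= energy s - cost D s b.
Proof.
case: s => A B w D0 D1 [/= AB w0].
have [E|nAB] := eqVneq A B.
  by rewrite /cost /move /= E eqxx; set p := right_prob _ _ _; lra.
have {}AB : A < B by rewrite lt_neqAle nAB.
rewrite /cost /= (negbTE nAB); set e := energy (Config A B w).
case: b; rewrite /mover_site /= /right_prob.
  rewrite energy_move_ll // energy_move_lr // -/e.
  have h1 := w0 A; have h2 := w0 (A - 1).
  rewrite -subr_ge0.
  set x := w A in h1 *; set y := w (A - 1) in h2 *.
  (* The drift pushes the left particle inward, which leaves this nonnegative slack. *)
  have -> : e - (1 - D) / ((y + x + D) * (y + 1)) -
     ((x + D) / (y + x + D) * (e - x^-1) +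
      (1 - (x + D) / (y + x + D)) * (e + (y + 1)^-1)) =
      D * ((y + 1)^-1 + x^-1) / (y + x + D).
    by field; do ?[apply/andP; split]; apply: lt0r_neq0; lra.
  by rewrite divr_ge0 ?mulr_ge0 ?addr_ge0 ?invr_ge0 //; lra.
rewrite energy_move_rl // energy_move_rr // -/e.
have h1 := w0 B; have h2 := w0 (B - 1).
set x := w B in h1 *; set y := w (B - 1) in h2 *.
(* For the right particle the mean change is exactly minus the cost. *)
rewrite le_eqVlt; apply/orP; left; apply/eqP.
by field; do ?[apply/andP; split]; apply: lt0r_neq0; lra.
Qed.

(** * Bounded total cost forces a meeting *)

Lemma left_moves_finite_range (R : realType) (D a C : R) (s : nat -> config R)
    (b right : nat -> bool) :
  0 <= D -> D < 1 -> 0 < a ->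
  (forall x, weight (s 0%N) x = a) ->
  (forall n, s n.+1 = move (s n) (b n) (right n)) ->
  (forall n, lpos (s n) < rpos (s n)) ->
  (forall n x, 0 < weight (s n) x) ->
  (forall N, \sum_(k < N) cost D (s k) (b k) <= C) ->
  (exists l, forall n, l <= lpos (s n)) /\
  ((exists m, forall n, lpos (s n) <= m) ->
   ~ forall N, exists2 n, (N <= n)%N & b n).
Proof.
move=> D0 D1 a0 wa sS AB w0 sC.
(* Reflection makes outward mean upward; it sends the edge [x, x + 1] to [-x - 1, -x], whose index
   is [- x - 1]. *)
pose z n := - lpos (s n); pose W n x := weight (s n) (- x - 1).
have K0 : 0 < 1 - D by lra.
have mv n : b n ->
  (z n.+1 = z n + 1 /\
     forall x, W n.+1 x = if x == z n then W n x + 1 else W n x) \/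
  (z n.+1 = z n - 1 /\
     forall x, W n.+1 x = if x == z n - 1 then W n x + 1 else W n x).
  move=> bn; rewrite /z /W sS /move bn lt_eqF // /jump /mover_site.
  case: (right n) => /=; [right|left]; (split; first lia) => x; rewrite /upd.
    have [->|nx] := eqVneq x (- lpos (s n) - 1).
      have -> : - (- lpos (s n) - 1) - 1 = lpos (s n) by lia.
      by rewrite eqxx.
    by rewrite ifF //; lia.
  have [->|nx] := eqVneq x (- lpos (s n)).
    by rewrite opprK eqxx.
  by rewrite ifF //; lia.
have st n : ~~ b n ->
  z n.+1 = z n /\ forall x : int, z n - 1 <= x -> W n.+1 x = W n x.
  move=> /negbTE bn; rewrite /z /W sS /move bn lt_eqF // /jump /mover_site.
  (* Crossing the edge [lpos (s n)] would bring the right particle onto the left one, which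
     [AB n.+1] excludes. *)
  have ABn := AB n; have := AB n.+1; rewrite sS /move bn lt_eqF // /jump /=.
  by case: (right n) => /= ABn1; split => // x zx; rewrite /upd ifF //; lia.
have Wa (x : int) : z 0%N <= x -> W 0%N x = a by move=> _; exact: wa.
have W0 n x : 0 < W n x by exact: w0.
have gC N : \sum_(k < N) (if b k then
    (1 - D) / ((W k (z k - 1) + W k (z k) + D) * (W k (z k) + 1)) else 0) <= C.
  apply: le_trans (sC N); apply: ler_sum => k _; case: ifPn => bk; last first.
    by apply: cost_ge0 => //; split => //; exact/ltW/AB.
  rewrite /cost lt_eqF // /mover_site /W /z.
  have -> : - (- lpos (s k) - 1) - 1 = lpos (s k) by lia.
  by rewrite opprK [weight _ _ + weight _ _]addrC.
split.
  have [M HM] := walker_bounded K0 D0 mv st W0 a0 Wa gC.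
  by exists (- M) => n; have := HM n; rewrite /z; lia.
move=> [m Hm].
have [M HM] := walker_bounded K0 D0 mv st W0 a0 Wa gC.
have zl n : - m <= z n by rewrite /z; have := Hm n; lia.
exact: (walker_not_oscillating K0 D0 mv st W0 gC zl HM).
Qed.

Lemma right_moves_finite_range (R : realType) (D a C : R) (s : nat -> config R)
    (b right : nat -> bool) :
  0 <= D -> D < 1 -> 0 < a ->
  (forall x, weight (s 0%N) x = a) ->
  (forall n, s n.+1 = move (s n) (b n) (right n)) ->
  (forall n, lpos (s n) < rpos (s n)) ->
  (forall n x, 0 < weight (s n) x) ->
  (forall N, \sum_(k < N) cost D (s k) (b k) <= C) ->
  (exists m, forall n, rpos (s n) <= m) /\
  ((exists l, forall n, l <= rpos (s n)) ->
   ~ forall N, exists2 n, (N <= n)%N & ~~ b n).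
Proof.
move=> D0 D1 a0 wa sS AB w0 sC.
pose z n := rpos (s n); pose W n := weight (s n); pose b' n := ~~ b n.
have K0 : 0 < 1 - D by lra.
have mv n : b' n ->
  (z n.+1 = z n + 1 /\
     forall x, W n.+1 x = if x == z n then W n x + 1 else W n x) \/
  (z n.+1 = z n - 1 /\
     forall x, W n.+1 x = if x == z n - 1 then W n x + 1 else W n x).
  move=> /negbTE bn; rewrite /z /W sS /move bn lt_eqF // /jump /mover_site.
  case: (right n) => /=; [left|right]; split => // x; rewrite /upd;
    by have [->|] := eqVneq.
have st n : ~~ b' n ->
  z n.+1 = z n /\ forall x : int, z n - 1 <= x -> W n.+1 x = W n x.
  rewrite negbK => bn; rewrite /z /W sS /move bn lt_eqF // /jump /mover_site.
  have ABn := AB n; have := AB n.+1; rewrite sS /move bn lt_eqF // /jump /=.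
  by case: (right n) => /= ABn1; split => // x zx; rewrite /upd ifF //; lia.
have Wa (x : int) : z 0%N <= x -> W 0%N x = a by move=> _; exact: wa.
have gC N : \sum_(k < N) (if b' k then
    (1 - D) / ((W k (z k - 1) + W k (z k) + D) * (W k (z k) + 1)) else 0) <= C.
  apply: le_trans (sC N); apply: ler_sum => k _; case: ifPn => bk; last first.
    by apply: cost_ge0 => //; split => //; exact/ltW/AB.
  by rewrite /cost lt_eqF // /mover_site (negbTE bk).
have [M HM] := walker_bounded K0 D0 mv st w0 a0 Wa gC.
split; first by exists M.
move=> [m Hm].
exact: (walker_not_oscillating K0 D0 mv st w0 gC Hm HM).
Qed.

(** Without a meeting each particle stays in a bounded range, the other one providing the inner
    bound. Then both move only finitely often, although at every time one of them moves. *)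
Lemma meet_of_bounded_cost (R : realType) (D a C : R) (s : nat -> config R)
    (b right : nat -> bool) :
  0 <= D -> D < 1 -> 0 < a -> lpos (s 0%N) <= rpos (s 0%N) ->
  (forall x, weight (s 0%N) x = a) ->
  (forall n, s n.+1 = move (s n) (b n) (right n)) ->
  (forall N, \sum_(k < N) cost D (s k) (b k) <= C) ->
  exists n, lpos (s n) = rpos (s n).
Proof.
move=> D0 D1 a0 AB0 wa sS sC; apply: contrapT => /forallNP nmeet.
have adm n : admissible (s n).
  elim: n => [|n IH]; first by split => // x; rewrite wa.
  by rewrite sS; exact: admissible_move.
have AB n : lpos (s n) < rpos (s n).
  by rewrite lt_neqAle (adm n).1 andbT; apply/eqP; exact: nmeet.
have w0 n := (adm n).2.
have [[l Hl] nl] := left_moves_finite_range D0 D1 a0 wa sS AB w0 sC.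
have [[m Hm] nr] := right_moves_finite_range D0 D1 a0 wa sS AB w0 sC.
apply: nl; first by exists m => n; exact: ltW (lt_le_trans (AB n) (Hm n)).
move=> N; apply: contrapT => nb; apply: nr.
  by exists l => n; exact: le_trans (Hl n) (ltW (AB n)).
move=> M; exists (maxn M N); first exact: leq_maxl.
by apply/negP => bn; apply: nb; exists (maxn M N) => //; exact: leq_maxr.
Qed.

(** * Independence *)

(** A pi-system generating the sigma-algebra of the [X i] with [i] in [J]. Repetitions in [F] are
    allowed, so that lists can be concatenated for intersections. *)
Definition cylinder (T : Type) (R : realType) (I : eqType) (X : I -> T -> R)
    (J : {pred I}) : set (set T) :=
  [set A | exists (F : seq I) (B : I -> set R),
    [/\ {subset F <= J}, forall i, measurable (B i) &
        A = \bigcap_(i in [set` F]) X i @^-1` B i]].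

Lemma setI_closed_cylinder (T : Type) (R : realType) (I : eqType)
  (X : I -> T -> R) (J : {pred I}) : setI_closed (cylinder X J).
Proof.
move=> _ _ [F [B [FJ mB ->]]] [G [C [GJ mC ->]]].
exists (F ++ G), (fun i => (if i \in F then B i else setT) `&`
                           (if i \in G then C i else setT)); split.
- by move=> i; rewrite mem_cat => /orP[/FJ|/GJ].
- by move=> i; apply: measurableI; case: ifP.
- apply/seteqP; split => [w [Bw Cw] i _|w BCw] /=.
    by split; case: ifPn => //; [exact: Bw|exact: Cw].
  split=> i /= iF; have /= := BCw i; rewrite mem_cat iF ?orbT => /(_ isT) [].
    by [].
  by [].
Qed.

Lemma sub_cylinder (T : Type) (R : realType) (I : eqType)
  (X : I -> T -> R) (J : {pred I}) i (B : set R) :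
  i \in J -> measurable B -> cylinder X J (X i @^-1` B).
Proof.
move=> iJ mB; exists [:: i], (fun=> B); split => //.
  by move=> j; rewrite inE => /eqP ->.
apply/seteqP; split => [w Bw j /=|w /(_ i) /=]; last by apply; rewrite inE.
by rewrite inE => /eqP ->.
Qed.

Section Independence.
Context (d : measure_display) (T : measurableType d) (R : realType).
Variables (P : probability T R) (I : eqType) (X : I -> T -> R) (J : {pred I}).
Hypothesis mX : forall i, measurable_fun setT (X i).

Lemma cylinder_measurable : <<s cylinder X J >> `<=` measurable.
Proof.
apply: smallest_sub; first exact: sigma_algebra_measurable.
move=> _ [F [B [_ mB ->]]]; apply: fin_bigcap_measurable => // i _.
by rewrite -[_ @^-1` _]setTI; exact: mX.
Qed.

Lemma independent_sigma_cylinder (j : I) (B : set R) (H : set T) :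
  mutually_independent P X -> j \notin J -> measurable B ->
  <<s cylinder X J >> H ->
  P (H `&` X j @^-1` B) = (P H * P (X j @^-1` B))%E.
Proof.
move=> indep jJ mB sH; set C := X j @^-1` B.
have mC : measurable C by rewrite /C -[_ @^-1` _]setTI; exact: mX.
suff : <<s cylinder X J >> `<=`
    [set A | measurable A /\ P (A `&` C) = (P A * P C)%E].
  by move=> /(_ _ sH) [].
rewrite -setI_closed_g_dynkin_g_sigma_algebra; last exact: setI_closed_cylinder.
apply: smallest_sub.
  split.
  - by split => //; rewrite setTI probability_setT mul1e.
  - move=> A [mA PA]; split; first exact: measurableC.
    have mCA : measurable (C `\` A) by exact: measurableD.
    have : (P C = P (C `\` A) + P (A `&` C))%E.
      by rewrite (setIC A); exact: measureDI.
    rewrite PA probability_setC //.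
    rewrite (setIC (~` A)) -setDE -(fineK (fin_num_measure P _ mA)).
    rewrite -(fineK (fin_num_measure P _ mC)).
    rewrite -(fineK (fin_num_measure P _ mCA)).
    rewrite -EFinM -EFinD => -[E].
    by rewrite -EFinB -EFinM; congr EFin; lra.
  - move=> F tF DF; split; first by apply: bigcupT_measurable => k; case: (DF k).
    have mF k : measurable (F k) by case: (DF k).
    rewrite setI_bigcupl (measure_bigcup P setT F) //.
    rewrite (measure_bigcup P setT) => [|k _|]; last 2 first.
    + exact: measurableI.
    + exact: trivIset_setIr.
    rewrite muleC -(fineK (fin_num_measure P _ mC)) -nneseriesZl //.
    apply: eq_eseriesr => k _; rewrite fineK; last exact: fin_num_measure.
    by rewrite muleC; exact: (DF k).2.
move=> A [F [D [FJ mD ->]]].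
have jF : j \notin undup F.
  by rewrite mem_undup; apply: contra jJ; exact: FJ.
have undupE : [set` undup F] = [set` F].
  by apply/seteqP; split => i /=; rewrite mem_undup.
(* With [B] placed at [j], one family serves for two uses of [indep]: on [j :: undup F] and on
   [undup F]. *)
pose D' i := if i == j then B else D i.
have mD' i : measurable (D' i) by rewrite /D'; case: ifP.
have D'E i : i \in undup F -> D' i = D i.
  by move=> iF; rewrite /D' ifF //; apply/negbTE; apply: contraNneq jF => <-.
split.
  apply: fin_bigcap_measurable => // i _; rewrite -[_ @^-1` _]setTI; exact: mX.
rewrite -undupE.
have -> : \bigcap_(i in [set` undup F]) X i @^-1` D i =
    \bigcap_(i in [set` undup F]) X i @^-1` D' i.
  by apply: eq_bigcapr => i iF; rewrite D'E.
have D'j : D' j = B by rewrite /D' eqxx.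
have ujF : uniq (j :: undup F) by rewrite /= jF undup_uniq.
have := indep _ ujF _ mD'.
rewrite big_cons D'j -/C -(indep _ (undup_uniq F) _ mD') muleC => <-.
congr (P _); apply/seteqP; split => [w [Dw Cw] i|w Dw] /=.
  by rewrite inE => /predU1P[->|]; [rewrite D'j | exact: Dw].
split; last by have /= := Dw j (mem_head _ _); rewrite D'j.
by move=> i iF; apply: Dw; rewrite /= inE orbC; apply/orP; left.
Qed.
End Independence.

(** The event contains [U w <= x - e] for every small e > 0, so there is no atom at [x]. *)
Lemma unif01_lt (d : measure_display) (T : measurableType d) (R : realType)
  (P : probability T R) (U : {RV P >-> R}) (x : R) :
  is_unif01 P U -> 0 <= x <= 1 -> P [set w | U w < x] = x%:E.
Proof.
move=> uU /andP[x0 x1].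
have mle y : measurable [set w | U w <= y].
  rewrite (_ : [set w | _] = U @^-1` `]-oo, y]); last first.
    by apply/seteqP; split => w /=; rewrite in_itv.
  by rewrite -[_ @^-1` _]setTI; exact: measurable_funPT.
have mlt y : measurable [set w | U w < y].
  rewrite (_ : [set w | _] = U @^-1` `]-oo, y[); last first.
    by apply/seteqP; split => w /=; rewrite in_itv.
  by rewrite -[_ @^-1` _]setTI; exact: measurable_funPT.
apply/eqP; rewrite eq_le; apply/andP; split.
  by rewrite -uU ?x0 // le_measure ?inE // => w /=; exact: ltW.
apply/lee_addgt0Pr => e e0.
have [xe|ex] := leP e x.
  rewrite -leeBlDr // -EFinB -uU; last by lra.
  rewrite le_measure ?inE // => w /= Uw; lra.
by apply: le_trans (_ : e%:E <= _)%E; rewrite ?lee_fin ?(ltW ex) // leeDr.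
Qed.

Lemma measurable_countable_factor (d : measure_display) (T : measurableType d)
  (d' : measure_display) (T' : measurableType d') (K : countType) (k : T -> K)
  (f : K -> T') : (forall x, measurable [set w | k w = x]) ->
  measurable_fun setT (f \o k).
Proof.
move=> mk _ Y mY; rewrite setTI.
rewrite (_ : _ @^-1` _ = \bigcup_x (if f x \in Y then [set w | k w = x] else set0)).
  apply: countable_bigcupT_measurable; first exact: countableP.
  by move=> x; case: ifP.
apply/seteqP; split => [w /= Yw|w [x _]].
  by exists (k w) => //; rewrite ifT //; exact/mem_set.
by case: ifPn => // /set_mem Yx /= E; rewrite /= E.
Qed.

(** * Expected costs *)

(* A history lists the jumps, latest first, each as a pair of bits
   (left particle moved, jump to the right). *)
Section History.
Context (R : realType).
Variables (D : R) (s0 : config R).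

Definition run (h : seq (bool * bool)) : config R :=
  foldr (fun m s => move s m.1 m.2) s0 h.

(** The bits in the history count the rings of each clock so far, so together with the waiting times
    they determine which clock rings next. *)
Definition left_next (e1 e2 : nat -> R) (h : seq (bool * bool)) : bool :=
  ring_time e1 (count fst h) <= ring_time e2 (count (predC fst) h).

Definition jump_prob (h : seq (bool * bool)) (b : bool) : R :=
  right_prob D (weight (run h)) (mover_site b (run h)).

Fixpoint history (e1 e2 u : nat -> R) (n : nat) : seq (bool * bool) :=
  if n is m.+1 then
    let h := history e1 e2 u m in
    let b := left_next e1 e2 h in
    (b, u m < jump_prob h b) :: h
  else [::].

Definition last_cost (h : seq (bool * bool)) : R :=
  if h is m :: h' then cost D (run h') m.1 else 0.

Lemma admissible_run h : admissible s0 -> admissible (run h).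
Proof. by move=> ?; elim: h => //= m h IH; exact: admissible_move. Qed.

Lemma last_cost_ge0 h : 0 <= D -> D < 1 -> admissible s0 -> 0 <= last_cost h.
Proof.
by move=> D0 D1 s0P; case: h => // m h; exact/cost_ge0/admissible_run.
Qed.
End History.

(** [move] freezes at a meeting while [lerp_step] goes on; without a meeting both perform the same
    updates. *)
Lemma lerp_traj_history (R : realType) (D a : R) (x0 y0 : int)
    (e1 e2 u : nat -> R) n :
  let s := lerp_traj D a x0 y0 e1 e2 u in
  (forall k, posA (s k) <> posB (s k)) ->
  let h := history D (Config x0 y0 (fun=> a)) e1 e2 u n in
  [/\ run (Config x0 y0 (fun=> a)) h = Config (posA (s n)) (posB (s n)) (wts (s n)),
      cnt1 (s n) = count fst h & cnt2 (s n) = count (predC fst) h].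
Proof.
move=> s nmeet; elim: n => [//|n /=]; set s0 := Config _ _ _.
set h := history _ _ _ _ _ n => -[IH1 IH2 IH3].
have -> : s n.+1 = lerp_step D e1 e2 (u n) (s n) by [].
rewrite /jump_prob IH1 /lerp_step IH2 IH3 -/(left_next e1 e2 h).
rewrite /move /= (negbTE (introN eqP (nmeet n))).
rewrite /lerp_jump /jump /right_prob /mover_site.
case: (left_next e1 e2 h) => /=; case: ifP => _ /=; split => //; lia.
Qed.

Section Probability.
Context (d : measure_display) (T : measurableType d) (R : realType).
Variables (P : probability T R) (E1 E2 U : nat -> {RV P >-> R}).
Variables (D : R) (s0 : config R).
Hypotheses (D0 : 0 <= D) (D1 : D < 1) (s0P : admissible s0).

Let X := lerp_family (fun n => E1 n : T -> R) (fun n => E2 n : T -> R)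
                     (fun n => U n : T -> R).
Hypothesis indep : mutually_independent P X.
Hypothesis unifU : forall n, is_unif01 P (U n).

Let hist n w := history D s0 (E1 ^~ w) (E2 ^~ w) (U ^~ w) n.

(** All waiting times, future ones included, count as known; only the uniform variables are revealed
    one by one. Thus [U n] is independent of this past although the past decides who jumps next. *)
Definition before (n : nat) : {pred nat + nat + nat} :=
  fun i => if i is inr k then (k < n)%N else true.

Lemma measurable_lerp_family i : measurable_fun setT (X i).
Proof. by case: i => [[n|n]|n] /=; exact: measurable_funPT. Qed.

Let past m : measurableType _ := g_sigma_algebraType (cylinder X (before m)).

Lemma measurable_past m i :
  i \in before m -> measurable_fun setT (X i : past m -> R).
Proof.
move=> im _ B mB; rewrite setTI; apply: sub_sigma_algebra.
exact: sub_cylinder.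
Qed.

Lemma measurable_left_next m h :
  measurable_fun setT ((fun w => left_next (E1 ^~ w) (E2 ^~ w) h) : past m -> bool).
Proof.
apply: measurable_fun_ler; apply: measurable_sum => i.
  exact: (@measurable_past m (inl (inl (i : nat)))).
exact: (@measurable_past m (inl (inr (i : nat)))).
Qed.

Definition next_event n h b : set T :=
  [set w | hist n w = h /\ left_next (E1 ^~ w) (E2 ^~ w) h = b].

Lemma hist_cons n h b r :
  [set w | hist n.+1 w = (b, r) :: h] =
  next_event n h b `&` [set w | (U n w < jump_prob D s0 h b) = r].
Proof.
apply/seteqP; split => [w /= [<- <- <-] //|w [[/= wh wb] wr]].
by rewrite /hist /= -/(hist n w) wh wb wr.
Qed.

Lemma measurable_hist_past m n h : (n <= m)%N ->
  measurable ([set w | hist n w = h] : set (past m)).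
Proof.
elim: n h => [|n IH] h nm.
  have [->|h0] := eqVneq h [::].
    by rewrite (_ : [set w | _] = setT) //; apply/seteqP; split.
  rewrite (_ : [set w | _] = set0) //; apply/seteqP; split => // w /= E.
  by rewrite -E in h0.
case: h => [|[b r] h].
  by rewrite (_ : [set w | _] = set0) //; apply/seteqP; split.
rewrite hist_cons; apply: measurableI.
  apply: measurableI; first by apply: IH; exact: ltnW.
  rewrite -[X in measurable X]setTI.
  exact: (measurable_left_next h measurableT (Y := [set b])).
have mlt : measurable_fun setT
    ((fun w => U n w < jump_prob D s0 h b) : past m -> bool).
  apply: measurable_fun_ltr; last exact: measurable_cst.
  exact: (@measurable_past m (inr n)).
rewrite -[X in measurable X]setTI.
exact: (mlt measurableT [set r]).
Qed.

Lemma next_event_past n h b : measurable (next_event n h b : set (past n)).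
Proof.
apply: measurableI; first exact: measurable_hist_past.
rewrite -[X in measurable X]setTI.
exact: (measurable_left_next h measurableT (Y := [set b])).
Qed.

Lemma past_measurable m (A : set T) : measurable (A : set (past m)) -> measurable A.
Proof. exact: cylinder_measurable measurable_lerp_family _. Qed.

Lemma measurable_hist n h : measurable [set w | hist n w = h].
Proof. by apply: (@past_measurable n); exact: measurable_hist_past. Qed.

Lemma measurable_next_event n h b : measurable (next_event n h b).
Proof. by apply: (@past_measurable n); exact: next_event_past. Qed.

(** [next_event n h b] belongs to the past of step [n], hence is independent of [U n], and the
    direction is decided by [U n] alone. *)
Lemma prob_jump_right n h b :
  P [set w | hist n.+1 w = (b, true) :: h] =
  (P (next_event n h b) * (jump_prob D s0 h b)%:E)%E.
Proof.
rewrite hist_cons -(unif01_lt (unifU n)); last first.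
  by apply: right_prob_01 => //; exact: (admissible_run h s0P).2.
have -> : [set w | U n w < jump_prob D s0 h b] =
          X (inr n) @^-1` `]-oo, jump_prob D s0 h b[.
  by apply/seteqP; split => w /=; rewrite in_itv.
apply: (independent_sigma_cylinder measurable_lerp_family indep (J := before n)).
- by rewrite unfold_in /= ltnn.
- exact: measurable_itv.
- exact: next_event_past.
Qed.

(** The two directions partition [next_event n h b], so this follows by subtraction. *)
Lemma prob_jump_left n h b :
  P [set w | hist n.+1 w = (b, false) :: h] =
  (P (next_event n h b) * (1 - jump_prob D s0 h b)%:E)%E.
Proof.
have mN := measurable_next_event n h b.
have mt := measurable_hist n.+1 ((b, true) :: h).
have mf := measurable_hist n.+1 ((b, false) :: h).
have : (P (next_event n h b) = P [set w | hist n.+1 w = (b, true) :: h] +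
    P [set w | hist n.+1 w = (b, false) :: h])%E.
  rewrite -measureU //; last first.
    by apply/seteqP; split => // w [/= -> []].
  congr (P _); rewrite !hist_cons -setIUr -[LHS]setIT; congr (_ `&` _).
  apply/seteqP; split => // w _ /=.
  by case: (U n w < _); [left|right].
rewrite prob_jump_right -(fineK (fin_num_measure P _ mN)).
rewrite -(fineK (fin_num_measure P _ mf)) -!EFinM -EFinD => -[E].
by congr EFin; lra.
Qed.

Let step_cost n (w : T) : \bar R := (last_cost D s0 (hist n.+1 w))%:E.

Lemma measurable_step_cost n : measurable_fun setT (step_cost n).
Proof.
apply/measurable_EFinP; apply: measurable_countable_factor => h.
exact: measurable_hist.
Qed.

Lemma step_cost_ge0 n w : (0 <= step_cost n w)%E.
Proof. by rewrite lee_fin last_cost_ge0. Qed.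

Lemma integral_split (A B C : set T) (f : T -> \bar R) :
  A = B `|` C -> B `&` C = set0 -> measurable B -> measurable C ->
  measurable_fun setT f -> (forall w, (0 <= f w)%E) ->
  (\int[P]_(w in A) f w = \int[P]_(w in B) f w + \int[P]_(w in C) f w)%E.
Proof.
move=> -> BC mB mC mf f0; rewrite ge0_integral_setU //.
  exact: measurable_funTS.
by rewrite disj_set2E BC eqxx.
Qed.

(* Supermartingale estimate: splitting according to the next jump, the energy
   at the start of the period pays for all costs incurred afterwards. *)
Lemma integral_cost_le j n h :
  (\int[P]_(w in [set w | hist n w = h]) (\sum_(k < j) step_cost (n + k)%N w)
    <= (energy (run s0 h))%:E * P [set w | hist n w = h])%E.
Proof.
elim: j n h => [|j IH] n h.
  rewrite (eq_integral (cst 0%E)) => [|w _]; last by rewrite big_ord0.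
  by rewrite integral0 mule_ge0 // lee_fin energy_ge0 //; exact: admissible_run.
pose F j n w := (\sum_(k < j) step_cost (n + k)%N w)%E.
have F0 i m w : (0 <= F i m w)%E by apply: sume_ge0 => k _; exact: step_cost_ge0.
have mF i m : measurable_fun setT (F i m).
  by apply: emeasurable_sum => k; exact: measurable_step_cost.
have mN b := measurable_next_event n h b.
have mH b r := measurable_hist n.+1 ((b, r) :: h).
have NE : [set w | hist n w = h] = next_event n h true `|` next_event n h false.
  apply/seteqP; split => [w /= E|w [[]|[]] //].
  by rewrite /next_event /=; case: left_next; [left|right].
have ND : next_event n h true `&` next_event n h false = set0.
  by apply/seteqP; split => // w [[_ E] [_]]; rewrite E.
have HE b : next_event n h b =
    [set w | hist n.+1 w = (b, true) :: h] `|`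
    [set w | hist n.+1 w = (b, false) :: h].
  rewrite !hist_cons -setIUr -[LHS]setIT; congr (_ `&` _).
  by apply/seteqP; split => // w _ /=; case: (U n w < _); [left|right].
have HD b : [set w | hist n.+1 w = (b, true) :: h] `&`
    [set w | hist n.+1 w = (b, false) :: h] = set0.
  by apply/seteqP; split => // w [/= -> []].
suff step b : (\int[P]_(w in next_event n h b) F j.+1 n w <=
    (energy (run s0 h))%:E * P (next_event n h b))%E.
  rewrite -[X in (X <= _)%E]/(\int[P]_(w in _) F j.+1 n w)%E.
  rewrite (integral_split NE ND) // NE measureU // ge0_muleDr //.
  exact: leeD.
(* Once the mover is known, the cost of the coming jump is a constant, whatever its direction. *)
have FS w : next_event n h b w ->
    F j.+1 n w = ((cost D (run s0 h) b)%:E + F j n.+1 w)%E.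
  move=> [wh wb]; rewrite /F big_ord_recl; congr (_ + _)%E.
    by rewrite /step_cost addn0 /= -/(hist n w) wh wb.
  by apply: eq_bigr => i _; rewrite lift0 addnS.
rewrite (eq_integral (fun w => (cost D (run s0 h) b)%:E + F j n.+1 w)%E);
  last by move=> w /set_mem; exact: FS.
have adm := admissible_run h s0P.
rewrite ge0_integralD //; last 2 first.
  by move=> w _; rewrite lee_fin cost_ge0.
  exact: measurable_funTS.
rewrite integral_cst // (integral_split (HE b) (HD b)) //.
apply: (@le_trans _ _ ((cost D (run s0 h) b)%:E * P (next_event n h b) +
  ((energy (run s0 ((b, true) :: h)))%:E *
     P [set w | hist n.+1 w = (b, true) :: h] +
   (energy (run s0 ((b, false) :: h)))%:E *
     P [set w | hist n.+1 w = (b, false) :: h]))%E).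
  by rewrite leeD2l // leeD // IH.
rewrite prob_jump_right prob_jump_left -(fineK (fin_num_measure P _ (mN b))).
set q := fine _; have q0 : 0 <= q by rewrite fine_ge0.
rewrite -!EFinM -!EFinD lee_fin.
have := energy_drift b D0 (ltW D1) adm.
rewrite -/(jump_prob D s0 h b) /=; set p := jump_prob _ _ _ _.
set et := energy _; set ef := energy _; set e := energy _; set c := cost _ _ _.
(* The claim is [energy_drift] multiplied by [q], the probability of [next_event n h b]. *)
move=> H; have : 0 <= q * (e - c - (p * et + (1 - p) * ef)).
  by rewrite mulr_ge0 // subr_ge0.
by rewrite !(mulrBr, mulrDr, mulrBl, mulrDl); lra.
Qed.

(** By monotone limits the expected total cost is at most the initial energy, and a nonnegative
    function with finite integral is almost everywhere finite. *)
Lemma ae_cost_lty : {ae P, forall w, (\sum_(n <oo) step_cost n w < +oo)%E}.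
Proof.
pose G w := (\sum_(n <oo) step_cost n w)%E.
have mG : measurable_fun setT G.
  apply: ge0_emeasurable_sum => [k w _ _|k _]; first exact: step_cost_ge0.
  exact: measurable_step_cost.
have G0 w : (0 <= G w)%E by apply: nneseries_ge0 => n _ _; exact: step_cost_ge0.
have iG : P.-integrable setT G.
  apply/integrableP; split => //.
  under eq_integral => w _ do rewrite gee0_abs //.
  rewrite integral_nneseries //; last 2 first.
  - exact: measurable_step_cost.
  - by move=> n w _; exact: step_cost_ge0.
  apply: (@le_lt_trans _ _ (energy s0)%:E); last exact: ltry.
  apply: lime_le.
    apply: is_cvg_nneseries => n _ _; apply: integral_ge0 => w _.
    exact: step_cost_ge0.
  apply: nearW => N; rewrite big_mkord -ge0_integral_sum //; last 2 first.
  - by move=> n; exact: measurable_step_cost.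
  - by move=> n w _; exact: step_cost_ge0.
  (* At time 0 the history is empty on the whole space. *)
  have := integral_cost_le N 0 [::].
  rewrite (_ : [set w | _] = setT); last by apply/seteqP; split.
  by rewrite probability_setT mule1.
have := integrable_ae measurableT iG.
apply: filterS => w /(_ I); rewrite fin_numE => /andP[_]; rewrite -ltey.
by [].
Qed.
End Probability.

(** * Almost sure finiteness of the meeting time *)

Unset Implicit Arguments.

Theorem theorem2 (d : measure_display) (T : measurableType d) (R : realType)
  (P : probability T R) (E1 E2 U : nat -> {RV P >-> R})
  (D a : R) (l0 r0 : int) :
  0 <= D -> D < 1 -> 0 < a -> l0 < r0 ->
  mutually_independent P
    (lerp_family (fun n => E1 n : T -> R) (fun n => E2 n : T -> R)
                 (fun n => U n : T -> R)) ->
  (forall n, is_exp1 P (E1 n)) ->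
  (forall n, is_exp1 P (E2 n)) ->
  (forall n, is_unif01 P (U n)) ->
  {ae P, forall w, meeting_time D a l0 r0
           (fun n => E1 n w) (fun n => E2 n w) (fun n => U n w) < +oo}%E.
Proof.
move=> D0 D1 a0 lr indep _ _ unifU.
pose s0 := Config l0 r0 (fun=> a).
have s0P : admissible s0 by split => //=; exact: ltW.
have := ae_cost_lty D0 D1 s0P indep unifU.
apply: filterS => w; set hist := history D s0 _ _ _ => sum_lty.
apply: contrapT => /negP; rewrite -leNgt => never.
(* A single meeting index would bound the infimum by a finite jump time. *)
have nmeet k : posA (lerp_traj D a l0 r0 (E1 ^~ w) (E2 ^~ w) (U ^~ w) k) <>
               posB (lerp_traj D a l0 r0 (E1 ^~ w) (E2 ^~ w) (U ^~ w) k).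
  move=> meet.
  suff : (+oo <= (time (lerp_traj D a l0 r0 (E1 ^~ w) (E2 ^~ w) (U ^~ w) k))%:E)%E.
    by rewrite leye_eq.
  by apply: (le_trans never); apply: ereal_inf_lbound; exists k.
pose s n := run s0 (hist n).
pose b n := left_next (E1 ^~ w) (E2 ^~ w) (hist n).
have [C sumC] : exists C : R, forall N, \sum_(k < N) cost D (s k) (b k) <= C.
  have cost_sum N : ((\sum_(k < N) cost D (s k) (b k))%:E <=
      \sum_(n <oo) (last_cost D s0 (hist n.+1))%:E)%E.
    rewrite -sumEFin -(big_mkord predT (fun k => (cost D (s k) (b k))%:E)).
    apply: nneseries_lim_ge => k _ _; rewrite lee_fin.
    exact: (last_cost_ge0 (hist k.+1) D0 D1 s0P).
  exists (fine (\sum_(n <oo) (last_cost D s0 (hist n.+1))%:E)%E) => N.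
  rewrite -lee_fin fineK; first by apply: cost_sum.
  rewrite ge0_fin_numE //; apply: nneseries_ge0 => k _ _.
  by rewrite lee_fin last_cost_ge0.
have [] := meet_of_bounded_cost (s := s) (b := b)
  (right := fun n => U n w < jump_prob D s0 (hist n) (b n)) D0 D1 a0 (ltW lr)
  (fun=> erefl) (fun=> erefl) sumC.
move=> n; rewrite /s.
by have [-> _ _] := lerp_traj_history n nmeet; exact: nmeet.
Qed.
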